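(* Let $G$ be a finitely generated abelian group. Then: (a) $s(G)=ns(G)$; (b) $s(G)=0$ if and only if $r_0(G)\leq 1$; (c) $s_0(G)=0$.
   Context: $\mathbb N=\{0,1,2,\dots\}$ and $\mathbb N_+=\mathbb N\setminus\{0\}$. Let $\phi$ be an endomorphism of an abelian group $G$. A string of $\phi$ is a sequence $S=\{x_n\}_{n\in\mathbb N}$ of pairwise distinct elements of $G$ such that $\phi(x_n)=x_{n-1}$ for every $n\in\mathbb N_+$. A string is singular if $\phi^j(x_0)=\phi^k(x_0)$ for some $j\neq k$ in $\mathbb N$, and non-singular otherwise; it is a null string if $x_0\neq 0$ and $\phi^k(x_0)=0$ for some $k\in\mathbb N_+$. Define $s(\phi)$ (respectively $ns(\phi)$, $s_0(\phi)$) as the supremum of the cardinalities $|\mathcal F|$, where $\mathcal F$ ranges over the families of pairwise disjoint strings (respectively non-singular strings, null strings) of $\phi$; if this supremum is infinite it is set equal to the symbol $\infty$. For an abelian group $G$, $s(G)=\sup\{s(\phi):\phi\in\mathrm{End}(G)\}$, $ns(G)=\sup\{ns(\phi):\phi\in\mathrm{End}(G)\}$, $s_0(G)=\sup\{s_0(\phi):\phi\in\mathrm{End}(G)\}$. $r_0(G)$ denotes the torsion-free rank of $G$. *)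

(* Defs.v *)
From mathcomp Require Import all_boot all_order all_algebra.
From mathcomp Require Import boolp classical_sets functions cardinality.
From mathcomp Require Import reals ereal measure.

Set Implicit Arguments.
Unset Strict Implicit.
Unset Printing Implicit Defensive.

Import Order.TTheory GRing.Theory Num.Theory.

Local Open Scope classical_set_scope.
Local Open Scope ring_scope.

(* Cardinalities take their values in {0, 1, 2, ..., +oo}, seen inside \bar R:
   [counting F] is the number of elements of F when F is finite, +oo otherwise.
   The real field R only serves as the carrier of these values. *)

Section Strings.
Variables (R : realType) (G : zmodType).

Section Endomorphism.
Variable phi : {additive G -> G}.

Definition is_string (x : nat -> G) : Prop :=
  injective x /\ forall n, phi (x n.+1) = x n.

Definition singular (x : nat -> G) : Prop :=
  exists j k : nat, j <> k /\ iter j phi (x 0%N) = iter k phi (x 0%N).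

Definition is_nonsingular_string (x : nat -> G) : Prop :=
  is_string x /\ ~ singular x.

Definition is_null_string (x : nat -> G) : Prop :=
  [/\ is_string x, x 0%N <> 0
    & exists k : nat, (0 < k)%N /\ iter k phi (x 0%N) = 0].

End Endomorphism.

(* Strings have nonempty ranges, so distinct members of a family F with
   [trivIset F range] are exactly pairwise disjoint strings.  The empty family
   is always admissible, so this supremum is never -oo. *)
Definition sup_disjoint (P : set (nat -> G)) : \bar R :=
  ereal_sup [set counting F | F in
    [set F : set (nat -> G) | F `<=` P /\ trivIset F (fun x => range x)]].

Definition s_endo (phi : {additive G -> G}) : \bar R :=
  sup_disjoint [set x | is_string phi x].

Definition ns_endo (phi : {additive G -> G}) : \bar R :=
  sup_disjoint [set x | is_nonsingular_string phi x].

Definition s0_endo (phi : {additive G -> G}) : \bar R :=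
  sup_disjoint [set x | is_null_string phi x].

Definition s_group : \bar R := ereal_sup (range s_endo).
Definition ns_group : \bar R := ereal_sup (range ns_endo).
Definition s0_group : \bar R := ereal_sup (range s0_endo).

Definition Zindependent (A : set G) : Prop :=
  forall (t : seq G) (c : G -> int), uniq t -> [set` t] `<=` A ->
    \sum_(x <- t) x *~ c x = 0 -> forall x, x \in t -> c x = 0.

Definition torsion_free_rank : \bar R :=
  ereal_sup [set counting A | A in [set A : set G | Zindependent A]].

Definition finitely_generated : Prop :=
  exists (n : nat) (g : 'I_n -> G),
    forall x, exists c : 'I_n -> int, x = \sum_(i < n) g i *~ c i.

End Strings.

Arguments s_group : clear implicits.
Arguments ns_group : clear implicits.
Arguments s0_group : clear implicits.
Arguments torsion_free_rank : clear implicits.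
Arguments finitely_generated : clear implicits.

(* Main.v *)
Require Import Defs.
From HB Require Import structures.
From mathcomp Require Import all_boot all_order all_algebra.
From mathcomp Require Import reals ereal.
From mathcomp Require Import boolp classical_sets functions cardinality measure.
From mathcomp Require Import finmap ring zify.

(** A finitely generated abelian group G is Noetherian
(subgroup_of_span), so for an endomorphism phi the increasing union of the
kernels of the iterates of phi is reached at some finite stage m
(ker_iter_stable).  Hence an element y killed by an iterate of phi and having
preimages under every iterate is zero: write y = phi^m(z); then z lies in the
union of the kernels, so phi^m already kills it
(nilpotent_divisible_eq0).  Applied to the head of a null string this shows
that there are no null strings.  If x is a string and
phi^j(x_0) = phi^(j+p)(x_0), apply it to y = x_p - x_0, whose preimages are the
x_(n+p) - x_n: it gives x_p = x_0, against injectivity.  So every string is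
non-singular, and s and ns are suprema over the same families.

The value of s(G) is governed by integer-valued forms on G.  An element no
nonzero multiple of which lies in a subgroup H can be detected by a
homomorphism f : G -> Z vanishing on H (exists_separating_form).

- If u and v are independent, take f with f(u) = 0 and f(v) <> 0.  The shear
  x |-> x + f(x) u translates v by f(v) u, and n |-> v - n f(v) u is a string
  (independent_string).

- If any two elements are dependent and G is not torsion, choose f nonzero.
  Its kernel is torsion, hence finite, and so are the sets where |f| is bounded
  (finite_strip).  Since G has rank 1, f (phi x) = lambda f(x) for a fixed
  rational lambda.  If lambda is nonzero then |lambda| >= 1, because phi maps
  an element minimizing |f| off the kernel to another element off the kernel;
  so f is bounded along a string, and this is also the case if lambda = 0.  An
  injective sequence cannot stay in a finite set (dependent_no_string).  If G is
torsion, it is finite, and the last argument applies to G itself. *)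

Set Implicit Arguments.
Unset Strict Implicit.
Unset Printing Implicit Defensive.

Import Order.TTheory GRing.Theory Num.Theory.

Local Open Scope classical_set_scope.
Local Open Scope ring_scope.

(** * Subgroups and their generators *)

Lemma exists_minimizer (T : Type) (P : set T) (m : T -> nat) :
  P !=set0 -> exists2 x, P x & forall y, P y -> (m x <= m y)%N.
Proof.
move=> [x0 Px0].
have ex : exists n, `[< exists2 x, P x & m x = n >].
  by exists (m x0); apply/asboolP; exists x0.
case: (ex_minnP ex) => n /asboolP[x Px mx] nmin.
exists x => // y Py; rewrite mx; apply: nmin.
by apply/asboolP; exists y.
Qed.

Lemma subrACA (G : zmodType) (x y z t : G) :
  (x - y) - (z - t) = (x - z) - (y - t).
Proof. by rewrite !opprD !opprK addrACA. Qed.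

Definition subgroup (G : zmodType) (H : set G) : Prop :=
  H 0 /\ forall x y, H x -> H y -> H (x - y).

Lemma subgroupN (G : zmodType) (H : set G) x : subgroup H -> H x -> H (- x).
Proof. by move=> [H0 HB] Hx; rewrite -[- x]add0r; apply: HB. Qed.

Lemma subgroupD (G : zmodType) (H : set G) x y :
  subgroup H -> H x -> H y -> H (x + y).
Proof.
move=> sH Hx Hy; rewrite -[y]opprK; apply: (proj2 sH) => //.
exact: subgroupN.
Qed.

Lemma subgroupMz (G : zmodType) (H : set G) x (c : int) :
  subgroup H -> H x -> H (x *~ c).
Proof.
move=> sH Hx.
have Hn n : H (x *+ n).
  elim: n => [|n IH]; first by rewrite mulr0n; case: sH.
  by rewrite mulrS; apply: subgroupD.
by case: c => n; [exact: Hn | exact: (subgroupN sH (Hn n.+1))].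
Qed.

Lemma subgroup_sum (G : zmodType) (H : set G) I (r : seq I) (F : I -> G) :
  subgroup H -> (forall i, H (F i)) -> H (\sum_(i <- r) F i).
Proof.
move=> sH HF; apply: big_ind => // [|x y]; first by case: sH.
exact: subgroupD.
Qed.

(** The subgroup generated by s, described by peeling off one generator at a
time so that inductions on s go through the successive subgroups. *)
Fixpoint span (G : zmodType) (s : seq G) : set G :=
  if s is g :: s' then [set x | exists c : int, span s' (x - g *~ c)]
  else [set 0].

Lemma span_subgroup (G : zmodType) (s : seq G) : subgroup (span s).
Proof.
elim: s => [|g s [s0 sB]] /=; first by split=> // x y -> ->; rewrite subr0.
split; first by exists 0; rewrite mulr0z subr0.
move=> x y [c xc] [d yd]; exists (c - d).
by rewrite mulrzBr subrACA; apply: sB.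
Qed.

Lemma mem_span (G : zmodType) (s : seq G) x : x \in s -> span s x.
Proof.
elim: s => //= g s IH; rewrite inE => /orP[/eqP ->|/IH sx].
  by exists 1; rewrite mulr1z subrr; case: (span_subgroup s).
by exists 0; rewrite mulr0z subr0.
Qed.

Lemma span_min (G : zmodType) (H : set G) (s : seq G) :
  subgroup H -> (forall x, x \in s -> H x) -> span s `<=` H.
Proof.
move=> sH; elim: s => [|g s IH] sub x /=; first by move=> ->; case: sH.
case=> c xc; rewrite -(subrK (g *~ c) x); apply: subgroupD => //.
  by apply: IH xc => y ys; apply: sub; rewrite inE ys orbT.
by apply: subgroupMz => //; apply: sub; rewrite mem_head.
Qed.

Lemma finitely_generatedP (G : zmodType) :
  finitely_generated G -> exists s : seq G, forall x, span s x.
Proof.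
move=> [n [g gP]]; exists (codom g) => x; have [c ->] := gP x.
apply: subgroup_sum; first exact: span_subgroup.
move=> i; apply: subgroupMz; first exact: span_subgroup.
by apply: mem_span; apply: codom_f.
Qed.

(** Z-modules of finite type are Noetherian.  Among the elements of H, pick x0
whose coefficient c0 along the first generator g is nonzero and smallest in
absolute value.  Euclidean division by c0 moves any element of H, modulo x0,
into the part of H spanned by the remaining generators. *)
Lemma subgroup_of_span (G : zmodType) (s : seq G) (H : set G) :
  subgroup H -> H `<=` span s ->
  exists2 t : seq G, (forall x, x \in t -> H x) & H `<=` span t.
Proof.
elim: s H => [|g s IH] H sH Hs.
  by exists [::] => // x /Hs.
have sS := span_subgroup s.
have sHs : subgroup (H `&` span s).
  split; first by split; [case: sH | case: sS].
  by move=> x y [Hx sx] [Hy sy]; split; [apply: (proj2 sH) | apply: (proj2 sS)].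
have [t tHs Hst] := IH _ sHs (@subIsetr _ _ _).
pose P : set (G * int) :=
  [set u | [/\ u.2 != 0, H u.1 & span s (u.1 - g *~ u.2)]].
have [P0|P0] := pselect (P !=set0); last first.
  exists t; first by move=> x /tHs[].
  move=> x Hx; apply: Hst; split=> //.
  have [c xc] : exists c, span s (x - g *~ c) := Hs x Hx.
  have [c0|c0] := eqVneq c 0; first by rewrite c0 mulr0z subr0 in xc.
  by case: P0; exists (x, c).
have [[x0 c0] [/= c0_neq0 Hx0 sx0] cmin] :=
  exists_minimizer (fun u => `|u.2|%N) P0.
exists (x0 :: t).
  by move=> x; rewrite inE => /orP[/eqP ->|/tHs[]].
move=> x Hx; have [c xc] : exists c, span s (x - g *~ c) := Hs x Hx.
exists (c %/ c0)%Z; apply: Hst.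
have Hx' : H (x - x0 *~ (c %/ c0)%Z).
  by apply: (proj2 sH) => //; apply: subgroupMz.
have sx' : span s (x - x0 *~ (c %/ c0)%Z - g *~ (c %% c0)%Z).
  have -> : (c %% c0)%Z = c - c0 * (c %/ c0)%Z.
    by rewrite {2}(divz_eq c c0) [c0 * _]mulrC addrAC subrr add0r.
  rewrite mulrzBr mulrzA subrACA -mulrzBl.
  by apply: (proj2 sS) => //; apply: subgroupMz.
have [r0|r0] := eqVneq (c %% c0)%Z 0.
  by split=> //; move: sx'; rewrite r0 mulr0z subr0.
have /= := cmin (x - x0 *~ (c %/ c0)%Z, (c %% c0)%Z) (And3 r0 Hx' sx').
have := ltz_mod c c0_neq0; have := modz_ge0 c c0_neq0; lia.
Qed.

(** The coefficient of each generator only matters modulo an integer that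
kills it, so finitely many combinations cover the span. *)
Lemma torsion_span_finite (G : zmodType) (s : seq G) :
  (forall x, x \in s -> exists2 m : int, m != 0 & x *~ m = 0) ->
  finite_set (span s).
Proof.
elim: s => [|g s IH] tor /=; first exact: finite_set1.
have [m m0 gm] := tor g (mem_head _ _).
have fs : finite_set (span s).
  by apply: IH => x xs; apply: tor; rewrite inE xs orbT.
apply: (@sub_finite_set _ _ [set g *+ i + y | i in `I_`|m|%N & y in span s]).
  move=> x [c xc]; exists `|(c %% m)%Z|%N.
    by have := ltz_mod c m0; have := modz_ge0 c m0; rewrite /=; lia.
  exists (x - g *~ c) => //.
  have -> : g *+ `|(c %% m)%Z| = g *~ c.
    rewrite pmulrn gez0_abs ?modz_ge0 // [in RHS](divz_eq c m).
    rewrite [RHS]mulrzDr [_ * m]mulrC mulrzA.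
    by rewrite gm mul0rz add0r.
  by rewrite addrC subrK.
by apply: finite_image2 => //; exact: finite_II.
Qed.

(** * Strings are non-singular and never null *)

Lemma iterB (G : zmodType) (phi : {additive G -> G}) k x y :
  iter k phi (x - y) = iter k phi x - iter k phi y.
Proof. by elim: k => //= k ->; rewrite raddfB. Qed.

Lemma iter0 (G : zmodType) (phi : {additive G -> G}) k : iter k phi 0 = 0.
Proof. by elim: k => //= k ->; rewrite raddf0. Qed.

Lemma ker_iter_subgroup (G : zmodType) (phi : {additive G -> G}) k :
  subgroup [set x | iter k phi x = 0].
Proof.
by split=> [|x y /= x0 y0] /=; rewrite ?iter0 // iterB x0 y0 subrr.
Qed.

(** The kernels of the iterates form a chain whose union K is a subgroup, hence
generated by finitely many elements; one iterate kills all of these, and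
therefore K. *)
Lemma ker_iter_stable (G : zmodType) (phi : {additive G -> G}) :
  finitely_generated G ->
  exists m, forall k x, iter k phi x = 0 -> iter m phi x = 0.
Proof.
move=> /finitely_generatedP[s sG].
have ker_le k l x : (k <= l)%N -> iter k phi x = 0 -> iter l phi x = 0.
  by move=> /subnK <- x0; rewrite iterD x0 iter0.
pose K : set G := [set x | exists k, iter k phi x = 0].
have sK : subgroup K.
  split; first by exists 0%N.
  move=> x y [k xk] [l yl]; exists (maxn k l).
  by rewrite iterB (ker_le k) ?leq_maxl // (ker_le l) ?leq_maxr // subrr.
have [t tK Kt] := subgroup_of_span sK (fun x _ => sG x).
suff [m mP] : exists m, forall x, x \in t -> iter m phi x = 0.
  exists m => k x xk; have /Kt tx : K x by exists k.
  exact: (span_min (ker_iter_subgroup phi m) mP).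
elim: t tK {Kt} => [|x t IH] tK; first by exists 0%N.
have [m mP] : exists m, forall x, x \in t -> iter m phi x = 0.
  by apply: IH => y yt; apply: tK; rewrite inE yt orbT.
have [k xk] := tK x (mem_head _ _).
exists (maxn k m) => y; rewrite inE => /orP[/eqP ->|/mP ym].
  exact: ker_le (leq_maxl _ _) xk.
exact: ker_le (leq_maxr _ _) ym.
Qed.

(** By stability of the kernels, the element y m, killed by some iterate, is
killed by the m-th one; but the m-th iterate sends it to y 0. *)
Lemma nilpotent_divisible_eq0 (G : zmodType) (phi : {additive G -> G})
    (y : nat -> G) k :
  finitely_generated G -> (forall n, iter n phi (y n) = y 0%N) ->
  iter k phi (y 0%N) = 0 -> y 0%N = 0.
Proof.
move=> /(ker_iter_stable phi)[m mP] yP yk.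
by rewrite -(yP m); apply: (mP (k + m)%N); rewrite iterD yP.
Qed.

Lemma iter_string (G : zmodType) (phi : {additive G -> G}) (x : nat -> G) n m :
  is_string phi x -> iter n phi (x (n + m)%N) = x m.
Proof. by move=> [_ xP]; elim: n => // n IH; rewrite iterSr addSn xP. Qed.

Lemma null_string_absurd (G : zmodType) (phi : {additive G -> G}) x :
  finitely_generated G -> ~ is_null_string phi x.
Proof.
move=> Gfg [xs x0 [k [_ xk]]]; apply: x0.
apply: (nilpotent_divisible_eq0 Gfg _ xk) => n.
by rewrite -[X in x X]addn0 iter_string.
Qed.

(** If the forward orbit of x_0 is eventually periodic with period p, then
x_p - x_0 is killed by an iterate of phi, whereas the differences
x_(n+p) - x_n are its successive preimages; so it vanishes. *)
Lemma string_nonsingular (G : zmodType) (phi : {additive G -> G}) x :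
  finitely_generated G -> is_string phi x -> is_nonsingular_string phi x.
Proof.
move=> Gfg xs; split=> // sing.
have [j [p [p0 eqjp]]] : exists j p, (0 < p)%N /\
    iter j phi (x 0%N) = iter (j + p) phi (x 0%N).
  case: sing => j [k [/eqP jk eqjk]].
  case: (ltngtP j k) jk => // jk _; [exists j, (k - j)%N | exists k, (j - k)%N];
    by rewrite subn_gt0 subnKC ?(ltnW jk).
pose d n := x (n + p)%N - x n.
have d0 : d 0%N = 0.
  apply: (@nilpotent_divisible_eq0 _ phi d (j + p)) => //.
    move=> n; rewrite /d iterB iter_string // -[X in x X - _]add0n; congr (_ - _).
    by rewrite -[X in x X]addn0 iter_string.
  rewrite /d add0n iterB iterD -[X in iter p _ (x X)]addn0 iter_string //.
  by rewrite eqjp subrr.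
move/eqP: d0; rewrite /d subr_eq0 => /eqP /(proj1 xs).
by rewrite add0n => p00; rewrite p00 in p0.
Qed.

(** * Integer-valued forms on a finitely generated group *)

(** Add the generators to H one by one whenever this keeps the nonzero multiples
of e out.  A generator that had to be refused has a nonzero multiple congruent
to a multiple of e, and an accepted one is congruent to 0.  In the end some
common multiple A x of every x in the span is congruent to a multiple of e
modulo H': the quotient by H' has rank one. *)
Lemma enlarge_avoiding (G : zmodType) (e : G) (s : seq G) (H : set G) :
  subgroup H -> (forall m : int, H (e *~ m) -> m = 0) ->
  exists (A : int) (H' : set G),
    [/\ A != 0, subgroup H', H `<=` H', (forall m : int, H' (e *~ m) -> m = 0)
      & forall x, span s x -> exists b : int, H' (x *~ A - e *~ b)].
Proof.
move=> sH He; elim: s => [|g s [A [H' [A0 sH' HH' He' sP]]]].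
  exists 1, H; split=> // x ->; exists 0.
  by rewrite mul0rz mulr0z subrr; case: sH.
(* Hg is the subgroup generated by H' and g *)
pose Hg : set G := [set x | exists c : int, H' (x - g *~ c)].
have [Hge|] := pselect (forall m : int, Hg (e *~ m) -> m = 0).
  exists A, Hg; split=> //.
  - split; first by exists 0; rewrite mulr0z subr0; case: sH'.
    move=> x y [c xc] [d yd]; exists (c - d).
    by rewrite mulrzBr subrACA; apply: (proj2 sH').
  - by move=> x /HH' H'x; exists 0; rewrite mulr0z subr0.
  move=> x [k] /sP[b xb]; exists b, (k * A).
  by rewrite mulrzA addrAC -mulrzBl.
move=> /existsNP[m /not_implyP[[c emc] /eqP m0]].
have c0 : c != 0.
  by apply: contra_neq m0 => c0; apply: He'; rewrite c0 mulr0z subr0 in emc.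
exists (A * c), H'; split=> //; first by rewrite mulf_neq0.
move=> x [k] /sP[b xb]; exists (b * c + m * (k * A)).
have -> : x *~ (A * c) - e *~ (b * c + m * (k * A)) =
    ((x - g *~ k) *~ A - e *~ b) *~ c - (e *~ m - g *~ c) *~ (k * A).
  rewrite !mulrzBl -!mulrzA (mulrC c) -mulrA mulrzDr opprD addrA.
  by rewrite opprB [_ - _ - e *~ (b * c)]addrAC addrA subrK.
by apply: (proj2 sH'); apply: subgroupMz.
Qed.

(** Modulo the subgroup H' just built, A x is congruent to b e for an integer b
that is unique because H' avoids e; the form is x |-> b, and takes the value A
at e. *)
Lemma exists_separating_form (G : zmodType) (e : G) (H : set G) :
  finitely_generated G -> subgroup H ->
  (forall m : int, H (e *~ m) -> m = 0) ->
  exists f : {additive G -> int}, (forall h, H h -> f h = 0) /\ f e != 0.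
Proof.
move=> /finitely_generatedP[s sG] sH He.
have [A [H' [A0 sH' HH' He' sP]]] := enlarge_avoiding s sH He.
have [f fP] := choice (fun x => sP x (sG x)).
have f_uniq x b : H' (x *~ A - e *~ b) -> f x = b.
  move=> xb; apply/eqP; rewrite -subr_eq0; apply/eqP/He'.
  have := proj2 sH' _ _ xb (fP x).
  by rewrite subrACA subrr sub0r opprB -mulrzBr.
have f_add : zmod_morphism f.
  move=> x y; apply: f_uniq.
  by rewrite mulrzBl mulrzBr subrACA; apply: (proj2 sH').
pose F : {additive G -> int} :=
  HB.pack_for {additive G -> int} f (GRing.isZmodMorphism.Build G int f f_add).
exists F; split=> /=.
  move=> h /HH' Hh; apply: f_uniq.
  by rewrite mulr0z subr0; apply: subgroupMz.
by rewrite (f_uniq e A) // subrr; case: sH'.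
Qed.

(** * Pairs of elements and the torsion-free rank *)

(** Dependence over Z of the pair (x, y), not of the set of its entries: (x, x)
is dependent for every x. *)
Definition dependent (G : zmodType) (x y : G) : Prop :=
  exists a b : int, (a != 0) || (b != 0) /\ x *~ a = y *~ b.

Lemma Zindependent_pair (G : zmodType) (x y : G) :
  ~ dependent x y -> Zindependent [set x; y].
Proof.
move=> ind t c ut txy sum0.
have xy : x != y.
  by apply/eqP => xy; apply: ind; exists 1, 1; split; rewrite ?oner_eq0 // xy.
(* t may miss x or y; extending the coefficients by 0 restores the full pair *)
pose d z := if z \in t then c z else 0.
have {}sum0 : x *~ d x + y *~ d y = 0.
  have tE : perm_eq t [seq z <- [:: x; y] | z \in t].
    apply: uniq_perm => //; first by rewrite filter_uniq //= inE xy.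
    move=> z; rewrite mem_filter andb_idr // => zt.
    by have [->|->] := txy z zt; rewrite !inE eqxx ?orbT.
  have <- : \sum_(z <- [:: x; y]) z *~ d z = x *~ d x + y *~ d y.
    by rewrite !big_cons big_nil addr0.
  rewrite -[RHS]sum0 (perm_big _ tE) big_filter [RHS]big_mkcond.
  by apply: eq_bigr => z _; rewrite /d; case: ifP; rewrite // mulr0z.
have /andP[/eqP dx0 /eqP dy0] : (d x == 0) && (d y == 0).
  apply: contra_notT ind; rewrite negb_and => dxy; exists (d x), (- d y).
  by rewrite oppr_eq0 mulrNz; split=> //; apply/eqP; rewrite -addr_eq0 sum0.
move=> z zt; have [zE|zE] := txy z zt; move: dx0 dy0; rewrite -zE /d zt //.
Qed.

Lemma Zindependent_mem2 (G : zmodType) (A : set G) (x y : G) :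
  Zindependent A -> A x -> A y -> x <> y -> ~ dependent x y.
Proof.
move=> indA Ax Ay xy [a [b [ab eqab]]].
pose c z := if z == x then a else - b.
have yx : (y == x) = false by apply/eqP => yx; apply: xy.
have c0 : forall z, z \in [:: x; y] -> c z = 0.
  apply: indA.
  - by rewrite /= inE eq_sym yx.
  - by move=> z; rewrite /= !inE => /orP[] /eqP ->.
  by rewrite !big_cons big_nil addr0 /c eqxx yx mulrNz eqab subrr.
have := c0 x (mem_head _ _); have := c0 y; rewrite /c eqxx yx !inE eqxx orbT.
by move=> /(_ isT) /eqP; rewrite oppr_eq0 => b0 a0; move: ab; rewrite a0 b0 eqxx.
Qed.

Lemma counting_le1 (R : realType) (T : choiceType) (A : set T) :
  (@counting T R A <= 1)%E <-> forall x y, A x -> A y -> x = y.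
Proof.
split.
  rewrite /counting; case: asboolP => // finA.
  rewrite lee_fin (ler_nat _ _ 1) => A1 x y Ax Ay.
  apply/eqP; apply: contraTT A1 => xy; rewrite -ltnNge.
  have <- : #|` [fset x; y]%fset| = 2%N by rewrite cardfs2 xy.
  apply: fsubset_leq_card; apply/fsubsetP => z.
  by rewrite !inE => /orP[] /eqP ->; rewrite in_fset_set //; apply: mem_set.
move=> A1; have [[x Ax]|/set0P/negP/negPn/eqP ->] := pselect (A !=set0).
  have -> : A = [set x] by apply/seteqP; split=> [y Ay|y ->] //; apply: A1.
  by rewrite /counting asboolT // fset_set1 cardfs1.
by rewrite /counting asboolT // fset_set0 cardfs0 lee_fin ler01.
Qed.

Lemma torsion_free_rank_le1 (R : realType) (G : zmodType) :
  (torsion_free_rank R G <= 1)%E <-> forall x y : G, dependent x y.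
Proof.
split=> [r1 x y|dep].
  apply: contrapT => ind; apply: (ind); exists 1, 1; split; first by [].
  rewrite !mulr1z; apply: (proj1 (counting_le1 R [set x; y])); try by [left|right].
  apply: le_trans r1; apply: ereal_sup_ubound; exists [set x; y] => //.
  exact: Zindependent_pair.
apply: ge_ereal_sup => _ [A indA <-]; apply/counting_le1 => x y Ax Ay.
by apply: contrapT => xy; apply: (Zindependent_mem2 indA Ax Ay xy).
Qed.

(** * Groups of rank at most one have no strings *)

(** The kernel of f is finitely generated and torsion, hence finite, and a
nonempty fiber is a translate of it. *)
Lemma finite_fiber (G : zmodType) (f : {additive G -> int}) (v : int) :
  finitely_generated G ->
  (forall x, f x = 0 -> exists2 m : int, m != 0 & x *~ m = 0) ->
  finite_set [set x | f x = v].
Proof.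
move=> /finitely_generatedP[s sG] tor.
have sK : subgroup [set x | f x = 0].
  by split=> [|x y /= x0 y0]; rewrite /= ?raddf0 // raddfB x0 y0 subrr.
have [t tK Kt] := subgroup_of_span sK (fun x _ => sG x).
have finK : finite_set (span t).
  by apply: torsion_span_finite => x /tK; apply: tor.
have [[x0 x0v]|nov] := pselect (exists x0, f x0 = v); last first.
  by apply: (sub_finite_set _ (finite_set0 _)) => x xv; apply: nov; exists x.
apply: (sub_finite_set _ (finite_image (fun y => x0 + y) finK)) => x xv.
exists (x - x0); last by rewrite addrC subrK.
by apply: Kt; rewrite /= raddfB xv x0v subrr.
Qed.

Lemma finite_strip (G : zmodType) (f : {additive G -> int}) (B : nat) :
  finitely_generated G ->
  (forall x, f x = 0 -> exists2 m : int, m != 0 & x *~ m = 0) ->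
  finite_set [set x | (`|f x| <= B)%N].
Proof.
move=> Gfg tor.
apply: (@sub_finite_set _ _ (\bigcup_(n in `I_B.+1)
    ([set x | f x = n%:Z] `|` [set x | f x = - n%:Z]))).
  by move=> x xB; exists `|f x|%N => //=; lia.
apply: bigcup_finite; first exact: finite_II.
by move=> n _; rewrite finite_setU; split; apply: finite_fiber.
Qed.

Lemma string_not_in_finite (G : zmodType) (phi : {additive G -> G}) x (A : set G) :
  is_string phi x -> finite_set A -> ~ (forall n, A (x n)).
Proof.
move=> [xinj _] finA xA; apply: infinite_nat.
have -> : [set: nat] = x @^-1` A by apply/seteqP; split=> // n _; apply: xA.
by apply: finite_preimage => // n m _ _; apply: xinj.
Qed.

(** With e minimizing |f| off the kernel of f, the relation
f (phi y) f(e) = f(y) f (phi e) makes phi act through f as multiplication by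
f (phi e) / f(e), a number that is 0 or of absolute value at least 1; so f is
bounded along the string.  Such a form f exists unless G is torsion, and then
G is finite. *)
Lemma dependent_no_string (G : zmodType) (phi : {additive G -> G}) x :
  finitely_generated G -> (forall y z : G, dependent y z) -> ~ is_string phi x.
Proof.
move=> Gfg dep xs.
have [tor|] := pselect (forall y : G, exists2 m : int, m != 0 & y *~ m = 0).
  have [s sG] := finitely_generatedP Gfg.
  by apply: (string_not_in_finite xs (torsion_span_finite (fun y _ => tor y))).
move=> /existsNP[e0 e0_free].
have s0 : subgroup [set (0 : G)] by split=> // y z -> ->; rewrite subr0.
have e0_avoid (m : int) : [set (0 : G)] (e0 *~ m) -> m = 0.
  by move=> e0m; apply: contrapT => /eqP m0; apply: e0_free; exists m.
have [f [_ fe0]] := exists_separating_form Gfg s0 e0_avoid.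
have [e /= fe emin] :=
  @exists_minimizer G [set y | f y != 0] (fun y => `|f y|%N) (ex_intro _ e0 fe0).
have ratio y : exists a b : int, a != 0 /\ y *~ a = e *~ b.
  have [a [b [ab yaeb]]] := dep y e; exists a, b; split=> //.
  apply: contraTneq ab => a0; rewrite a0 eqxx /= negbK.
  have /eqP := congr1 f yaeb.
  by rewrite !raddfMz a0 mulr0z eq_sym mulrz_eq0 (negbTE fe) orbF.
have ker_tor y : f y = 0 -> exists2 m : int, m != 0 & y *~ m = 0.
  move=> fy; have [a [b [a0 yaeb]]] := ratio y; exists a => //.
  have /eqP := congr1 f yaeb; rewrite !raddfMz fy mul0rz eq_sym mulrz_eq0.
  by rewrite (negbTE fe) orbF yaeb => /eqP ->; rewrite mulr0z.
(* apply f, and f after phi, to a relation a y = b e, and eliminate a and b *)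
have eigen y : f (phi y) * f e = f y * f (phi e).
  have [a [b [a0 yaeb]]] := ratio y; apply: (mulfI a0).
  have fyaeb : a * f y = b * f e.
    by have := congr1 f yaeb; rewrite !raddfMz /= !mulrzz ![_ * f _]mulrC.
  have fpyaeb : a * f (phi y) = b * f (phi e).
    have := congr1 (f \o phi) yaeb.
    by rewrite /= !raddfMz /= !mulrzz ![_ * f _]mulrC.
  by rewrite !mulrA fpyaeb fyaeb; ring.
have step n : (`|f (x n.+1)| <= `|f (x 0%N)|)%N.
  have down m : f (x m) * f e = f (x m.+1) * f (phi e).
    by rewrite -(proj2 xs m) eigen.
  have [fpe0|fpe] := eqVneq (f (phi e)) 0.
    move: (down n.+1) => /eqP; rewrite fpe0 mulr0 mulf_eq0 (negbTE fe) orbF.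
    by move=> /eqP ->.
  have decr m : (`|f (x m.+1)| <= `|f (x m)|)%N.
    rewrite -(@leq_pmul2r `|f e|%N) ?absz_gt0 // -(abszM (f (x m))) down abszM.
    by rewrite leq_mul2l emin ?orbT.
  by elim: n => [|n IH]; [exact: decr | exact: leq_trans (decr _) IH].
by apply: (string_not_in_finite xs (finite_strip `|f (x 0%N)| Gfg ker_tor)) => -[|n] //=.
Qed.

(** * Strings from independent pairs *)

(** A transvection when f(e) = 0; the finite-dimensional model is the unipotent
Jordan block of size 2. *)
Definition shear (G : zmodType) (f : G -> int) (e x : G) : G := x + e *~ f x.

Lemma shear_additive (G : zmodType) (f : {additive G -> int}) (e : G) :
  zmod_morphism (shear f e).
Proof.
move=> x y; rewrite /shear raddfB /= mulrzBr.
by rewrite opprD addrACA.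
Qed.

HB.instance Definition _ (G : zmodType) (f : {additive G -> int}) (e : G) :=
  GRing.isZmodMorphism.Build G G (shear f e) (shear_additive f e).

Lemma shear_string (G : zmodType) (f : {additive G -> int}) (u v : G) :
  f u = 0 -> f v != 0 -> (forall m : int, u *~ m = 0 -> m = 0) ->
  is_string (shear f u) (fun n => v - u *~ (f v * n%:Z)).
Proof.
move=> fu fv u_free; split.
  move=> n m /= /addrI /oppr_inj /eqP; rewrite -subr_eq0 -mulrzBr => /eqP /u_free.
  by rewrite -mulrBr => /eqP; rewrite mulf_eq0 (negbTE fv) subr_eq0 => /eqP[].
move=> n; rewrite /= /shear raddfB raddfMz fu mul0rz subr0.
by rewrite intS mulrDr mulr1 mulrzDr opprD addrA addrAC subrK.
Qed.

Lemma independent_string (G : zmodType) (u v : G) :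
  finitely_generated G -> ~ dependent u v ->
  exists (phi : {additive G -> G}) x, is_string phi x.
Proof.
move=> Gfg ind.
pose H : set G := [set u *~ c | c in [set: int]].
have sH : subgroup H.
  split; first by exists 0; rewrite ?mulr0z.
  by move=> _ _ [c _ <-] [d _ <-]; exists (c - d); rewrite ?mulrzBr.
have v_avoid (m : int) : H (v *~ m) -> m = 0.
  move=> [c _ ucvm]; apply: contrapT => /eqP m0; apply: ind.
  by exists c, m; rewrite m0 orbT.
have [f [fH fv]] := exists_separating_form Gfg sH v_avoid.
have fu : f u = 0 by apply: fH; exists 1; rewrite ?mulr1z.
exists (shear f u), (fun n => v - u *~ (f v * n%:Z)).
apply: shear_string => // m um0; apply: contrapT => /eqP m0; apply: ind.
by exists m, 0; rewrite m0 um0 mulr0z.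
Qed.

(** * Counting disjoint strings *)

Lemma sup_disjoint_eq0 (R : realType) (G : zmodType) (P : set (nat -> G)) :
  P = set0 -> @sup_disjoint R G P = 0%E.
Proof.
move=> P0.
have c0 : @counting (nat -> G) R set0 = 0%E.
  by rewrite /counting asboolT // fset_set0 cardfs0.
apply/eqP; rewrite eq_le; apply/andP; split.
  apply: ge_ereal_sup => _ [F [FP _] <-]; rewrite P0 subset0 in FP.
  by rewrite FP c0.
apply: ereal_sup_ubound; exists set0 => //; split; first exact: sub0set.
by move=> i j [].
Qed.

Lemma sup_disjoint_ge1 (R : realType) (G : zmodType) (P : set (nat -> G)) x :
  P x -> (1 <= @sup_disjoint R G P)%E.
Proof.
move=> Px; apply: ereal_sup_ubound; exists [set x].
  by split=> [_ ->|i j -> ->].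
by rewrite /counting asboolT // fset_set1 cardfs1.
Qed.

Theorem proposition2p10 (R : realType) (G : zmodType)
    (Gfg : finitely_generated G) :
  [/\ s_group R G = ns_group R G,
      s_group R G = 0%E <-> (torsion_free_rank R G <= 1)%E
    & s0_group R G = 0%E].
Proof.
have id_in (F : {additive G -> G} -> \bar R) phi : (F phi <= ereal_sup (range F))%E.
  by apply: ereal_sup_ubound; exists phi.
have sup0 (F : {additive G -> G} -> \bar R) :
    (forall phi, F phi = 0%E) -> ereal_sup (range F) = 0%E.
  move=> F0; apply/eqP; rewrite eq_le -{2}(F0 idfun) id_in andbT.
  by apply: ge_ereal_sup => _ [phi _ <-]; rewrite F0.
split.
- rewrite /s_group; suff -> : @s_endo R G = @ns_endo R G by [].
  apply/funext => phi; congr sup_disjoint; apply/seteqP; split=> x /=; last by case.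
  by move=> xs; apply: string_nonsingular.
- rewrite torsion_free_rank_le1; split=> [s0 u v|dep].
    apply: contrapT => /(independent_string Gfg)[phi [x xs]].
    have := le_trans (sup_disjoint_ge1 R xs) (id_in (@s_endo R G) phi).
    by rewrite -[ereal_sup _]/(s_group R G) s0 lee_fin ler10.
  apply: sup0 => phi; apply: sup_disjoint_eq0; apply/seteqP; split=> // x.
  exact: dependent_no_string.
apply: sup0 => phi; apply: sup_disjoint_eq0; apply/seteqP; split=> // x.
exact: null_string_absurd.
Qed.
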